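(* Let $2\le n\le 7$. Every Hamiltonian cycle $h=h_0h_1\cdots h_{2^n-1}$ of $Q_n$ (indices mod $2^n$) contains an inscribed square: there exist a 4-cycle $v_0v_1v_2v_3$ of $Q_n$ and indices $a,b$ such that $h_ah_{a+1}h_bh_{b+1}$ equals $v_0v_1v_2v_3$ or $v_0v_1v_3v_2$; equivalently, $h$ contains two edges that are opposite edges of a 4-cycle of $Q_n$.
   Context: $Q_n$ is the $n$-dimensional hypercube: vertex set $\{0,1\}^n$, two vertices adjacent iff they differ in exactly one coordinate. *)

(* Defs.v *)
From mathcomp Require Import all_boot.

Set Implicit Arguments.
Unset Strict Implicit.
Unset Printing Implicit Defensive.

Definition cube (n : nat) := {ffun 'I_n -> bool}.

Definition cube_adj (n : nat) : rel (cube n) :=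
  [rel x y : cube n | #|[set i | x i != y i]| == 1].

Definition cube_4cycle (n : nat) (v0 v1 v2 v3 : cube n) : Prop :=
  ucycle (@cube_adj n) [:: v0; v1; v2; v3].

(* Indices modulo [2 ^ n] are ordinals, and [ordS] is the cyclic successor
   i |-> i + 1 mod 2 ^ n. For n = 0, 1 there is no cycle, only a closed walk;
   the definition is meant for 2 <= n. *)
Definition hamiltonian_cycle (n : nat) (h : 'I_(2 ^ n) -> cube n) : Prop :=
  bijective h /\ forall i, cube_adj (h i) (h (ordS i)).

Definition inscribed_square (n : nat) (h : 'I_(2 ^ n) -> cube n) : Prop :=
  exists v0 v1 v2 v3 : cube n, cube_4cycle v0 v1 v2 v3 /\
  exists a b : 'I_(2 ^ n),
    [:: h a; h (ordS a); h b; h (ordS b)] = [:: v0; v1; v2; v3] \/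
    [:: h a; h (ordS a); h b; h (ordS b)] = [:: v0; v1; v3; v2].

Definition cycle_edges (n : nat) (h : 'I_(2 ^ n) -> cube n) : {set {set cube n}} :=
  [set [set h i; h (ordS i)] | i : 'I_(2 ^ n)].

Definition opposite_edges_in (n : nat) (h : 'I_(2 ^ n) -> cube n) : Prop :=
  exists v0 v1 v2 v3 : cube n,
    [/\ cube_4cycle v0 v1 v2 v3,
        [set v0; v1] \in cycle_edges h & [set v2; v3] \in cycle_edges h].

(* Main.v *)
(** In a cycle without inscribed square every vertex [x] uses two directions, and
    if [x] uses direction [j] then its neighbour in a direction [k != j] does not.
    For [n <= 6] unit propagation and a short case analysis show that no such
    assignment of directions to the vertices exists. For [n = 7] symmetry comes
    first. If four consecutive directions of the cycle were never distinct, then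
    the directions would have period 3 and the cycle length 6. So some four
    consecutive edges have distinct directions [a0], [a1], [a2], [a3]; let [v] be
    the vertex in their middle. The vertex [v + e_a1 + e_a2] avoids all four, hence
    uses two further directions [a4], [a5], and up to a permutation of the
    coordinates [ai = i]. From there the same case analysis, taking the vertices
    in the order of their distance from [v], needs about two thousand leaves. *)

Require Import Defs.
From mathcomp Require Import all_boot fingroup perm.

Set Implicit Arguments.
Unset Strict Implicit.
Unset Printing Implicit Defensive.

(** * Verified case analysis *)

Fixpoint flip (s : bitseq) (j : nat) : bitseq :=
  match s, j with
  | [::], _ => [::]
  | b :: s', 0 => ~~ b :: s'
  | b :: s', j'.+1 => b :: flip s' j'
  end.

(* [(s, i, b)] says whether ([b]) the edge at [s] in direction [i] is chosen. *)
Definition fact := (bitseq * nat * bool)%type.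

(** A binary tree read along the letters of a word. A [Row] lists the directions at one vertex, with
    [None] for an undecided edge. *)
Inductive table := Row of seq (option bool) | Split of table & table.

Fixpoint lookup (t : table) (s : bitseq) : seq (option bool) :=
  match t, s with
  | Row l, _ => l
  | Split t0 t1, b :: s' => lookup (if b then t1 else t0) s'
  | Split _ _, [::] => [::]
  end.

Fixpoint update (t : table) (s : bitseq) (l : seq (option bool)) : table :=
  match t, s with
  | Row _, _ => Row l
  | Split t0 t1, b :: s' =>
      if b then Split t0 (update t1 s' l) else Split (update t0 s' l) t1
  | Split _ _, [::] => t
  end.

Fixpoint blank (n d : nat) : table :=
  if d is d'.+1 then Split (blank n d') (blank n d') else Row (nseq n None).

Definition same (x : option bool) (b : bool) : bool :=
  if x is Some c then c (+) ~~ b else false.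

(* More than [m] entries [b] contradict the degree condition; every entry [~~ b]
   is then a consequence, so that [propagate] finds the conflict. *)
Definition consequences (n : nat) (s : bitseq) (i : nat) (b : bool)
    (l : seq (option bool)) : seq fact :=
  (flip s i, i, b) ::
  (if b then [seq (flip s j, i, false) | j <- iota 0 n & j != i] else [::]) ++
  (let m := if b then 2 else n - 2 in
   let c := count (same^~ b) l in
   if m <= c
   then [seq (s, j, ~~ b) | j <- iota 0 n & (m < c) || ~~ nth None l j]
   else [::]).

(* [None] means that the facts are contradictory. *)
Fixpoint propagate (n fuel : nat) (t : table) (q : seq fact) : option table :=
  match fuel, q with
  | k.+1, (s, i, b) :: q' =>
      let l := lookup t s in
      if nth None l i is Some c then
        if c (+) b then None else propagate n k t q'
      else let l' := set_nth None l i (Some b) in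
        propagate n k (update t s l') (consequences n s i b l' ++ q')
  | _, _ => Some t
  end.

Fixpoint refute (n fuel : nat) (t : table) (es : seq (bitseq * nat)) : bool :=
  if es is (s, i) :: es' then
    if nth None (lookup t s) i then refute n fuel t es'
    else all (fun b => if propagate n fuel t [:: (s, i, b)] is Some t'
                       then refute n fuel t' es' else true) [:: true; false]
  else false.

(** Here [w] is the number of letters [true], so running through increasing [w] orders the vertices
    by distance from the zero word. *)
Fixpoint words (n w : nat) : seq bitseq :=
  match n, w with
  | 0, 0 => [:: [::]]
  | 0, _ => [::]
  | n'.+1, 0 => [:: nseq n'.+1 false]
  | n'.+1, w'.+1 =>
      map (cons false) (words n' w) ++ map (cons true) (words n' w')
  end.

Definition slots (n : nat) : seq (bitseq * nat) :=
  [seq (s, i) | s <- flatten [seq words n w | w <- iota 0 n.+1], i <- iota 0 n].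

Definition refuted (n : nat) (q : seq fact) : bool :=
  let fuel := 2 ^ (2 * n) in
  if propagate n fuel (blank n n) q is Some t then refute n fuel t (slots n)
  else true.


(** * Soundness of the case analysis *)

Definition holds (n : nat) (m : bitseq -> nat -> bool) (f : fact) : bool :=
  let: (s, i, b) := f in [&& size s == n, i < n & m s i == b].

(** A 2-factor of the cube with no two opposite edges of a 4-cycle, encoded on words. *)
Definition model (n : nat) (m : bitseq -> nat -> bool) : Prop :=
  forall s, size s = n ->
    [/\ count (m s) (iota 0 n) = 2,
        forall i, i < n -> m (flip s i) i = m s i
      & forall i j, i < n -> j < n -> j != i -> m s i -> ~~ m (flip s j) i].

Definition row_agrees (n : nat) (r : nat -> bool) (l : seq (option bool)) :=
  size l = n /\ forall i c, nth None l i = Some c -> r i = c.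

Fixpoint agrees (n : nat) (m : bitseq -> nat -> bool) (d : nat) (t : table) :=
  match d, t with
  | 0, Row l => row_agrees n (m [::]) l
  | d'.+1, Split t0 t1 => agrees n (fun s => m (false :: s)) d' t0 /\
                          agrees n (fun s => m (true :: s)) d' t1
  | _, _ => False
  end.

Lemma size_flip (s : bitseq) (j : nat) : size (flip s j) = size s.
Proof. by elim: s j => [|b s IH] [|j] //=; rewrite IH. Qed.

Lemma nth_flip (s : bitseq) (i j : nat) :
  j < size s -> nth false (flip s j) i = nth false s i (+) (i == j).
Proof.
elim: s i j => [|b s IH] [|i] [|j] //= lt_j; rewrite ?addbT ?addbF ?IH //.
Qed.

Lemma agrees_blank (n d : nat) (m : bitseq -> nat -> bool) :
  agrees n m d (blank n d).
Proof.
elim: d m => [|d IH] m /=; last by split.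
by split=> [|i c]; rewrite ?size_nseq // nth_nseq; case: ifP.
Qed.

Lemma agrees_lookup (n d : nat) (m : bitseq -> nat -> bool) (t : table)
    (s : bitseq) :
  agrees n m d t -> size s = d -> row_agrees n (m s) (lookup t s).
Proof.
elim: d m t s => [|d IH] m [l|t0 t1] [|b s] //= [ag0 ag1] [sz_s].
by case: b; [apply: (IH (fun s => m (true :: s)))
            | apply: (IH (fun s => m (false :: s)))].
Qed.

Lemma agrees_update (n d : nat) (m : bitseq -> nat -> bool) (t : table)
    (s : bitseq) (l : seq (option bool)) :
  agrees n m d t -> size s = d -> row_agrees n (m s) l ->
  agrees n m d (update t s l).
Proof.
elim: d m t s => [|d IH] m [l'|t0 t1] [|b s] //= [ag0 ag1] [sz_s] ag_l.
by case: b ag_l => ag_l; split=> //;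
  [apply: (IH (fun s => m (true :: s)))
  | apply: (IH (fun s => m (false :: s)))].
Qed.

Lemma row_agrees_set (n i : nat) (b : bool) (r : nat -> bool)
    (l : seq (option bool)) :
  i < n -> r i = b -> row_agrees n r l ->
  row_agrees n r (set_nth None l i (Some b)).
Proof.
move=> lt_in ri [sz_l ag_l]; split=> [|j c].
  by rewrite size_set_nth sz_l; apply/maxn_idPr.
by rewrite nth_set_nth /=; case: eqP => [-> [<-]|_ /ag_l].
Qed.

(** Splitting [p] into [a] and its complement in [p] shows that the complement has count 0. It
    serves when the decided entries of a row already reach the allowed number. *)
Lemma sub_count_eq (T : eqType) (a p : pred T) (s : seq T) :
  subpred a p -> count p s <= count a s -> {in s, forall x, p x -> a x}.
Proof.
move=> sub_ap le_pa x x_s px; apply/idPn => nax.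
have := count_predUI a [pred y | p y && ~~ a y] s.
rewrite [X in _ + X](@eq_count _ _ pred0); last first.
  by move=> y /=; case: (a y); rewrite ?andbF.
rewrite count_pred0 addn0 (@eq_count _ (predU _ _) p); last first.
  by move=> y /=; have := sub_ap y; case: (a y) => /= [->|_] //; rewrite andbT.
move=> eq_c; move: le_pa.
rewrite eq_c -{2}[count a s]addn0 leq_add2l leqNgt -has_count.
by move/negP; apply; apply/hasP; exists x => //=; rewrite px.
Qed.

Lemma consequencesP (n i : nat) (b : bool) (m : bitseq -> nat -> bool)
    (s : bitseq) (l : seq (option bool)) :
  model n m -> holds n m (s, i, b) -> row_agrees n (m s) l ->
  all (holds n m) (consequences n s i b l).
Proof.
move=> m_model /and3P[/eqP sz_s lt_in /eqP ms_i] [sz_l ag_l].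
have [cnt_s flip_s sq_s] := m_model s sz_s.
rewrite /= size_flip sz_s eqxx lt_in flip_s // ms_i eqxx /= all_cat.
apply/andP; split.
  case: b ms_i => //= ms_i; rewrite all_map all_filter; apply/allP => j.
  rewrite mem_iota /= add0n => lt_jn; apply/implyP => ne_ji /=.
  by rewrite size_flip sz_s eqxx lt_in eqbF_neg sq_s.
(* [k] is the exact number of directions with value [b] at [s]: 2 for chosen edges, [n - 2] for the
   others. *)
set k := (X in X <= _).
have cnt_b : count (fun j => m s j == b) (iota 0 n) = k.
  rewrite /k; case: (b).
    by rewrite -cnt_s; apply: eq_count => j; rewrite eqb_id.
  rewrite -cnt_s -[X in X - _](size_iota 0 n) -(count_predC (m s)) addKn.
  by apply: eq_count => j /=; rewrite eqbF_neg.
have cnt_l :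
    count (same^~ b) l = count (fun j => same (nth None l j) b) (iota 0 n).
  by rewrite -{1}(mkseq_nth None l) sz_l /mkseq count_map.
have sub_l : subpred (fun j => same (nth None l j) b) (fun j => m s j == b).
  move=> j; case E: (nth None l j) => [c|//]; rewrite (ag_l _ _ E) /=.
  by case: (c); case: (b).
rewrite cnt_l; case: ifP => // le_kc.
rewrite all_map all_filter; apply/allP => j j_n.
(* Decided entries cannot outnumber the true ones, so only the case of equality remains, where
   [sub_count_eq] gives every undecided entry the value [~~ b]. *)
rewrite /= -/k -cnt_b ltnNge sub_count //=; apply/implyP => nth_j.
move: (j_n); rewrite mem_iota /= add0n => -> /=; rewrite sz_s eqxx /=.
have [//|ms_j] := eqVneq (m s j) (~~ b).
have {}ms_j : m s j == b by move: ms_j; case: (m s j) (b) => [] [].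
have := @sub_count_eq _ _ _ (iota 0 n) sub_l _ j j_n ms_j.
by rewrite cnt_b le_kc => /(_ isT); case: (nth None l j) nth_j.
Qed.

(** Only consequences of true facts are ever queued, so no conflict arises. When the fuel runs out
    the current table is returned and still agrees with [m]; soundness thus holds for any amount of
    fuel. *)
Lemma propagateP (n fuel : nat) (m : bitseq -> nat -> bool) (t : table)
    (q : seq fact) :
  model n m -> agrees n m n t -> all (holds n m) q ->
  if propagate n fuel t q is Some t' then agrees n m n t' else False.
Proof.
move=> m_model; elim: fuel t q => [|k IH] t [|[[s i] b] q] //= ag_t.
move=> /andP[f_holds q_holds].
have /and3P[/eqP sz_s lt_in /eqP ms_i] := f_holds.
have ag_l := agrees_lookup ag_t sz_s.
case E: (nth None (lookup t s) i) => [c|].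
  by rewrite -(ag_l.2 _ _ E) ms_i addbb; apply: IH.
have ag_l' := row_agrees_set lt_in ms_i ag_l.
apply: IH; first exact: agrees_update.
by rewrite -cat_cons all_cat consequencesP.
Qed.

(** At each open slot the branch with the value of [m] survives propagation. Following these
    branches leads to the empty list, where [refute] answers [false]. *)
Lemma refuteP (n fuel : nat) (m : bitseq -> nat -> bool) (t : table)
    (es : seq (bitseq * nat)) :
  model n m -> agrees n m n t ->
  all (fun e => (size e.1 == n) && (e.2 < n)) es -> ~~ refute n fuel t es.
Proof.
move=> m_model; elim: es t => [|[s i] es IH] t //= ag_t.
move=> /andP[/andP[sz_s lt_in] es_ok].
case: (nth _ _ _) => [c|]; first exact: IH.
have := @propagateP n fuel m t [:: (s, i, m s i)] m_model ag_t.
rewrite /= sz_s lt_in eqxx => /(_ isT).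
by case: (m s i); case: (propagate _ _ _ _) => // t' /IH /(_ es_ok) /negPf->;
  rewrite ?andbF.
Qed.

Lemma size_words (n w : nat) : all (fun s => size s == n) (words n w).
Proof.
elim: n w => [|n IH] [|w] //=; first by rewrite size_nseq eqxx.
rewrite all_cat !all_map.
by apply/andP; split; apply: sub_all (IH _) => s /=; rewrite eqSS.
Qed.

Lemma refutedP (n : nat) (m : bitseq -> nat -> bool) (q : seq fact) :
  model n m -> all (holds n m) q -> ~~ refuted n q.
Proof.
move=> m_model q_holds; rewrite /refuted.
have := propagateP (2 ^ (2 * n)) m_model (agrees_blank n n m) q_holds.
case: propagate => // t ag_t; apply: refuteP m_model ag_t _.
apply/allP => e /allpairsP[[s i] [/flattenP[_ /mapP[w _ ->] s_w] i_n ->]] /=.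
by rewrite (allP (size_words n w)) //; move: i_n; rewrite mem_iota.
Qed.

(** * Cube coordinates *)

Section Flips.
Variable n : nat.
Implicit Types (x : cube n) (i j k : 'I_n).

Definition cflip x j : cube n := [ffun i => x i (+) (i == j)].

Lemma cflipK x j : cflip (cflip x j) j = x.
Proof. by apply/ffunP => i; rewrite !ffunE addbK. Qed.

Lemma cflipC x j k : cflip (cflip x j) k = cflip (cflip x k) j.
Proof. by apply/ffunP => i; rewrite !ffunE addbAC. Qed.

Lemma cflip_inj x : injective (cflip x).
Proof. by move=> j k /ffunP/(_ j); rewrite !ffunE eqxx => /addbI/esym/eqP. Qed.

Lemma cflip_neq x j : cflip x j != x.
Proof. by apply/eqP => /ffunP/(_ j); rewrite !ffunE eqxx; case: (x j). Qed.

Lemma cube_adjP x y : reflect (exists j, y = cflip x j) (cube_adj x y).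
Proof.
apply: (iffP cards1P) => -[j]; last first.
  move=> ->; exists j; apply/setP => i; rewrite !inE !ffunE.
  by case: (x i) (i == j) => [] [].
move=> /setP x_y; exists j; apply/ffunP => i; rewrite !ffunE.
by have := x_y i; rewrite !inE => <-; case: (x i) (y i) => [] [].
Qed.

Lemma cflip_4cycle x j k :
  j != k -> cube_4cycle x (cflip x j) (cflip (cflip x j) k) (cflip x k).
Proof.
move=> ne_jk; apply/andP; split.
  rewrite /cycle /= andbT; apply/and4P; split; apply/cube_adjP.
  - by exists j.
  - by exists k.
  - by exists j; rewrite cflipC cflipK.
  - by exists k; rewrite cflipK.
rewrite /= !inE !negb_or andbT -!andbA.
have ne_opp : x != cflip (cflip x j) k.
  apply: contra ne_jk => /eqP/ffunP/(_ j); rewrite !ffunE eqxx.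
  by case: (x j) (j == k) => [] [].
rewrite ne_opp 2!(eq_sym x) !cflip_neq (eq_sym (cflip x j)) cflip_neq.
by rewrite (inj_eq (@cflip_inj x)) ne_jk cflipC cflip_neq.
Qed.

Record square_free_factor (M : cube n -> 'I_n -> bool) : Prop :=
  SquareFreeFactor {
  factor_flip : forall x j, M (cflip x j) j = M x j;
  factor_card : forall x, #|[set j | M x j]| = 2;
  factor_square : forall x j k, k != j -> M x j -> ~~ M (cflip x k) j
}.

(** The automorphism of the cube that sends the zero word to [v] and direction [i] to [p i]. *)
Definition chart (v : cube n) (p : {perm 'I_n}) (s : bitseq) : cube n :=
  [ffun i => v i (+) nth false s (p^-1%g i)].

Definition pullback (M : cube n -> 'I_n -> bool) v p (s : bitseq) (j : nat) :=
  if insub j is Some i then M (chart v p s) (p i) else false.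

Lemma pullbackE M v p s i : pullback M v p s i = M (chart v p s) (p i).
Proof. by rewrite /pullback (valK i). Qed.

Lemma chart0 v p : chart v p (nseq n false) = v.
Proof. by apply/ffunP => i; rewrite ffunE nth_nseq ltn_ord addbF. Qed.

Lemma chart_flip v p s i :
  size s = n -> chart v p (flip s i) = cflip (chart v p s) (p i).
Proof.
move=> sz_s; apply/ffunP => j; rewrite !ffunE nth_flip ?sz_s ?ltn_ord // addbA.
by rewrite (inj_eq val_inj) -(inj_eq (@perm_inj _ p)) permKV.
Qed.

Lemma model_pullback M v p : square_free_factor M -> model n (pullback M v p).
Proof.
move=> [M_flip M_card M_square] s sz_s; split.
- rewrite -val_enum_ord count_map -[RHS](M_card (chart v p s)).
  rewrite -(card_preimset _ (@perm_inj _ p)) cardE -size_filter enumT.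
  congr (size _); rewrite /enum_mem; apply: eq_filter => i /=.
  by rewrite pullbackE !inE.
- move=> i lt_in; rewrite -[i]/(nat_of_ord (Ordinal lt_in)).
  by rewrite !pullbackE chart_flip // M_flip.
- move=> i j lt_in lt_jn; rewrite -[i]/(nat_of_ord (Ordinal lt_in)).
  rewrite -[j]/(nat_of_ord (Ordinal lt_jn)).
  rewrite !pullbackE chart_flip // => ne_ji; apply: M_square.
  by rewrite (inj_eq (@perm_inj _ p)).
Qed.
End Flips.

(** Appending the missing ordinals to [t] gives a rearrangement of all of ['I_n]. *)
Lemma perm_of_uniq (n : nat) (t : seq 'I_n) :
  uniq t ->
  exists p : {perm 'I_n}, forall i : 'I_n, i < size t -> p i = nth i t i.
Proof.
move=> t_uniq; pose t' := t ++ [seq i <- enum 'I_n | i \notin t].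
have t'_enum : perm_eq t' (enum 'I_n).
  apply: uniq_perm; rewrite ?enum_uniq //.
    rewrite cat_uniq t_uniq filter_uniq ?enum_uniq // andbT -all_predC.
    by apply/allP => i; rewrite mem_filter => /andP[].
  by move=> i; rewrite mem_cat mem_filter mem_enum andbT orbN.
have sz_t' : size t' == n by rewrite (perm_size t'_enum) size_enum_ord.
have t'P : perm_eq (Tuple sz_t') (ord_tuple n) by [].
have [p t'_p] := tuple_permP t'P; exists p => i lt_i.
have -> : nth i t i = nth i t' i by rewrite nth_cat lt_i.
rewrite -[t']/(tval (Tuple sz_t')) t'_p.
by rewrite -tnth_nth tnth_mktuple tnth_ord_tuple.
Qed.

(** * Directions along a Hamiltonian cycle *)

Section Hamiltonian.
Variables (n : nat) (h : 'I_(2 ^ n) -> cube n) (g : cube n -> 'I_(2 ^ n)).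
Variable d : 'I_(2 ^ n) -> 'I_n.
Hypotheses (hK : cancel h g) (gK : cancel g h).
Hypothesis h_step : forall i, h (ordS i) = cflip (h i) (d i).
Implicit Types (x : cube n) (i : 'I_(2 ^ n)).

Definition uses x (j : 'I_n) : bool :=
  (d (g x) == j) || (d (ord_pred (g x)) == j).

Lemma usesE i j : uses (h i) j = (d i == j) || (d (ord_pred i) == j).
Proof. by rewrite /uses hK. Qed.

Lemma h_pred i : h (ord_pred i) = cflip (h i) (d (ord_pred i)).
Proof. by rewrite -{2}(ord_predK i) h_step cflipK. Qed.

Lemma uses_flip x j : uses (cflip x j) j = uses x j.
Proof.
have sub y : uses y j -> uses (cflip y j) j.
  rewrite -{1 2}(gK y) usesE => /orP[] /eqP <-.
    by rewrite -h_step usesE ordSK eqxx orbT.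
  by rewrite -h_pred usesE eqxx.
by apply/idP/idP => /sub //; rewrite cflipK.
Qed.

Lemma val_iter_ordS k i : iter k (@ordS _) i = (i + k) %% 2 ^ n :> nat.
Proof.
elim: k => [|k IH]; first by rewrite addn0 modn_small.
by rewrite iterS /= IH -addn1 modnDml -addnA addn1.
Qed.

Lemma iter_ordS_id k i : iter k (@ordS _) i = i -> 2 ^ n %| k.
Proof.
move/(congr1 val) => /=; rewrite val_iter_ordS -{2}(modn_small (ltn_ord i)) => /eqP.
by rewrite -{2}(addn0 i) eqn_modDl mod0n.
Qed.

(** Repeating a direction would bring the cycle back after two steps, yet its length exceeds 2. *)
Lemma d_succ i : 1 < n -> d (ordS i) != d i.
Proof.
move=> lt1n; apply/eqP => d_eq.
have /iter_ordS_id/(@dvdn_leq _ 2 isT) : iter 2 (@ordS _) i = i.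
  by apply: (can_inj hK); rewrite /= !h_step d_eq cflipK.
by rewrite leqNgt -[X in X < _](expn1 2) ltn_exp2l // lt1n.
Qed.

Lemma card_uses x : 1 < n -> #|[set j | uses x j]| = 2.
Proof.
move=> lt1n; have -> : [set j | uses x j] = [set d (g x); d (ord_pred (g x))].
  by apply/setP => j; rewrite !inE /uses !(eq_sym j).
by rewrite cards2 -{1}(ord_predK (g x)) d_succ.
Qed.

(* Otherwise the directions have period 3, and six steps close the cycle. *)
Lemma aperiodic_step :
  ~~ (2 ^ n %| 6) -> exists i, d (iter 3 (@ordS _) i) != d i.
Proof.
move=> ndvd; apply/existsP; apply: contraNT ndvd.
rewrite negb_exists => /forallP d3.
have {}d3 i : d (iter 3 (@ordS _) i) = d i.
  by apply/eqP; rewrite -[_ == _]negbK d3.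
pose i := g [ffun=> false]; apply: (@iter_ordS_id 6 i); apply: (can_inj hK).
have := d3 (ordS (ordS i)); have := d3 (ordS i); have := d3 i.
rewrite /= !h_step => -> -> ->; apply/ffunP => j; rewrite !ffunE.
by case: (h i j) (_ == _) (_ == _) (_ == _) => [] [] [] [].
Qed.

Lemma uses_index x j : uses x j ->
  exists i, [/\ h (ordS i) = cflip (h i) j & h i = x \/ h (ordS i) = x].
Proof.
rewrite -{1}(gK x) usesE => /orP[] /eqP <-.
  by exists (g x); rewrite h_step gK; split; [|left].
exists (ord_pred (g x)); rewrite h_step.
by split; rewrite // -h_step ord_predK gK; right.
Qed.

(** The edges in direction [j] at [x] and at its neighbour in direction [k] are opposite in the
    4-cycle spanned by [j] and [k]. *)
Lemma square_of_uses x j k : k != j -> uses x j -> uses (cflip x k) j ->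
  inscribed_square h /\ opposite_edges_in h.
Proof.
move=> ne_kj x_j x'_j; have [a [ha hx]] := uses_index x_j.
(* The base point moves from [x] to the vertex where the cycle enters the first edge, which may be
   its other end. *)
have {x_j x'_j hx} : uses (cflip (h a) k) j.
  case: hx => [->|hx] //; move: x'_j.
  by rewrite -hx ha cflipC uses_flip.
set y := h a in ha * => /uses_index[b [hb hy]].
have sq : cube_4cycle y (cflip y j) (cflip (cflip y j) k) (cflip y k).
  by apply: cflip_4cycle; rewrite eq_sym.
(* The second edge is run through parallel or antiparallel to the first; these are the two patterns
   of an inscribed square. *)
have {}hy : (h b = cflip y k /\ h (ordS b) = cflip (cflip y j) k) \/
            (h b = cflip (cflip y j) k /\ h (ordS b) = cflip y k).
  case: hy => hy; [left|right]; split=> //.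
    by rewrite hb hy cflipC.
  by rewrite -(cflipK (h b) j) -hb hy cflipC.
split; exists y, (cflip y j), (cflip (cflip y j) k), (cflip y k).
  by split=> //; exists a, b; case: hy => -[-> ->]; rewrite ha; [right|left].
split=> //; apply/imsetP; first by exists a; rewrite // ha.
by exists b => //; case: hy => -[-> ->]; rewrite // setUC.
Qed.

Lemma uses_word : 1 < n -> ~~ (2 ^ n %| 6) ->
  (forall x j k, k != j -> uses x j -> ~~ uses (cflip x k) j) ->
  exists v a0 a1 a2 a3 a4 a5,
    [/\ uniq [:: a0; a1; a2; a3; a4; a5], uses v a1 && uses v a2,
        uses (cflip v a1) a0, uses (cflip v a2) a3
      & uses (cflip (cflip v a1) a2) a4 && uses (cflip (cflip v a1) a2) a5].
Proof.
move=> lt1n ndvd sqfree; have [i d30] := aperiodic_step ndvd.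
pose d0 := d i; pose d1 := d (ordS i); pose d2 := d (ordS (ordS i)).
pose d3 := d (ordS (ordS (ordS i))); pose v := h (ordS (ordS i)).
have v1E : cflip v d1 = h (ordS i) by rewrite /v h_step cflipK.
have v2E : cflip v d2 = h (ordS (ordS (ordS i))) by rewrite /v -h_step.
have v_d1 : uses v d1 by rewrite usesE ordSK eqxx orbT.
have v_d2 : uses v d2 by rewrite usesE eqxx.
have v1_d0 : uses (cflip v d1) d0 by rewrite v1E usesE ordSK eqxx orbT.
have v1_d1 : uses (cflip v d1) d1 by rewrite uses_flip.
have v2_d2 : uses (cflip v d2) d2 by rewrite uses_flip.
have v2_d3 : uses (cflip v d2) d3 by rewrite v2E usesE eqxx.
have d10 : d1 != d0 by apply: d_succ.
have d21 : d2 != d1 by apply: d_succ.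
have d32 : d3 != d2 by apply: d_succ.
(* As [cflip v d1] uses [d0], its neighbour [v] does not, whereas [v] uses [d2]. The case of [d3]
   and [d1] is symmetric. *)
have d20 : d2 != d0.
  by apply: contraL v_d2 => /eqP->; rewrite -(cflipK v d1); apply: sqfree.
have d31 : d3 != d1.
  apply: contraL v_d1 => /eqP d31; rewrite -(cflipK v d2).
  by apply: sqfree; rewrite // -d31.
pose w := cflip (cflip v d1) d2.
have wE : w = cflip (cflip v d2) d1 by rewrite /w cflipC.
have /eqP/cards2P[a4 [a5 [ne_a a_def]]] := card_uses w lt1n.
have w_a4 : uses w a4 by have /setP/(_ a4) := a_def; rewrite !inE eqxx.
have w_a5 : uses w a5 by have /setP/(_ a5) := a_def; rewrite !inE eqxx orbT.
(* [w] is adjacent to [cflip v d1], which uses [d0] and [d1], and to [cflip v d2], which uses [d2]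
   and [d3]; each neighbour excludes its two directions. *)
have w_new j : uses w j -> j \notin [:: d0; d1; d2; d3].
  move=> w_j; rewrite !inE !negb_or; apply/and4P.
  split; apply: contraTneq w_j => ->.
  - exact: sqfree.
  - exact: sqfree.
  - by rewrite wE; apply: sqfree; rewrite // eq_sym.
  - by rewrite wE; apply: sqfree; rewrite // eq_sym.
exists v, d0, d1, d2, d3, a4, a5; split; rewrite ?v_d1 ?w_a4 //.
rewrite -[_ :: _]/([:: d0; d1; d2; d3] ++ [:: a4; a5]) cat_uniq.
apply/and3P; split; first 1 last.
- by rewrite /= orbF negb_or; apply/andP; split; apply: w_new.
- by rewrite /= inE ne_a.
rewrite /= !inE !negb_or (eq_sym d0 d1) (eq_sym d0 d2) (eq_sym d0 d3).
by rewrite (eq_sym d1 d2) (eq_sym d1 d3) (eq_sym d2 d3) d10 d20 d30 d21 d31 d32.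
Qed.
End Hamiltonian.

(** * The computations and the conclusion *)

Definition word_facts (n : nat) : seq fact :=
  let o := nseq n false in
  [:: (o, 1, true); (o, 2, true); (flip o 1, 0, true); (flip o 2, 3, true);
      (flip (flip o 1) 2, 4, true); (flip (flip o 1) 2, 5, true)].

Lemma refuted_small : all (refuted^~ [::]) (iota 2 5).
Proof. by vm_compute. Qed.

Lemma refuted_7 : refuted 7 (word_facts 7).
Proof. by vm_compute. Qed.

Theorem theorem6 (n : nat) (hn : 2 <= n <= 7)
    (h : 'I_(2 ^ n) -> cube n) (hh : hamiltonian_cycle h) :
  inscribed_square h /\ opposite_edges_in h.
Proof.
have [[g hK gK] h_adj] := hh; have /andP[lt1n le_n7] := hn.
have /fin_all_exists[d h_step] : forall i, exists j, h (ordS i) = cflip (h i) j.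
  by move=> i; apply/cube_adjP.
have [/existsP[x /existsP[j /existsP[k /and3P[]]]]|] :=
  boolP [exists x, exists j, exists k,
           [&& k != j, uses g d x j & uses g d (cflip x k) j]].
  exact: square_of_uses.
move=> no_square; exfalso.
have sqfree x j k : k != j -> uses g d x j -> ~~ uses g d (cflip x k) j.
  move=> ne_kj x_j; apply: contraNN no_square => x'_j.
  apply/existsP; exists x; apply/existsP; exists j.
  by apply/existsP; exists k; apply/and3P.
have factor : square_free_factor (uses g d).
  split=> //; first by move=> x j; apply: uses_flip hK gK h_step x j.
  by move=> x; apply: card_uses hK h_step x lt1n.
have [lt_n7|ge_n7] := ltnP n 7.
  have := refutedP (q := [::]) (model_pullback [ffun=> false] 1%g factor) isT.
  by rewrite (allP refuted_small) // mem_iota lt1n.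
have n7 : n = 7 by apply/eqP; rewrite eqn_leq le_n7.
have [|v [a0 [a1 [a2 [a3 [a4 [a5]]]]]]] := uses_word hK gK h_step lt1n _ sqfree.
  by rewrite n7.
case=> a_uniq /andP[v1 v2] v10 v23 /andP[v124 v125].
(* In the chart centred at [v] with this [p], the six uses found above become exactly
   [word_facts]. *)
have [p pE] := perm_of_uniq a_uniq.
have := refutedP (q := word_facts n) (model_pullback v p factor).
suff -> : all (holds n (pullback (uses g d) v p)) (word_facts n).
  by move=> /(_ isT); rewrite n7 refuted_7.
have lt_n i : i < 7 -> i < n by rewrite n7.
(* The numerals in [word_facts] have to be read as elements of ['I_n] before [pullbackE] and
   [chart_flip] apply. *)
pose dir i (lt_i : i < 7) := p (Ordinal (lt_n i lt_i)).
have dirE i (lt_i : i < 7) :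
    i < 6 -> dir i lt_i = nth a0 [:: a0; a1; a2; a3; a4; a5] i.
  by move=> lt_i6; rewrite /dir pE //; apply: set_nth_default.
have readE s i (lt_i : i < 7) :
    pullback (uses g d) v p s i = uses g d (chart v p s) (dir i lt_i).
  by rewrite -pullbackE.
have flipE s i (lt_i : i < 7) :
    size s = n -> chart v p (flip s i) = cflip (chart v p s) (dir i lt_i).
  by move=> sz_s; rewrite -chart_flip.
rewrite /= !size_flip !size_nseq !eqxx !lt_n //.
rewrite !(readE _ 0 isT, readE _ 1 isT, readE _ 2 isT).
rewrite !(readE _ 3 isT, readE _ 4 isT, readE _ 5 isT).
rewrite !(flipE _ 1 isT, flipE _ 2 isT) ?size_flip ?size_nseq //.
rewrite chart0 !dirE //=.
by rewrite v1 v2 v10 v23 v124 v125.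
Qed.
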